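(* Let $m,n \in \mathbb{N}^*$ and $G \simeq C_m \oplus C_{mn}$. Let $S$ be a zero-sumfree sequence in $G$ with $|S| = m+mn-2$. Then: (i) if $n$ is a prime power (including $n=1$), $S$ contains at least $mn-1$ elements (counted with multiplicity) of order $mn$; (ii) if $n$ is not a prime power, $S$ contains at least $\left\lceil \frac{4}{5}mn + \frac{n-5}{5}\right\rceil$ elements (counted with multiplicity) of order $mn$.
   Context: $C_k$ denotes the cyclic group of order $k$. A sequence in a finite abelian group $G$ (written additively) is a finite list $S=(g_1,\dots,g_\ell)$ of elements of $G$ (repetitions allowed), of length $|S|=\ell$. $S$ is zero-sumfree if $\sum_{i\in I} g_i \neq 0$ for every non-empty $I \subseteq \{1,\dots,\ell\}$. (Note that $m+mn-2$ is the maximal length of a zero-sumfree sequence in $C_m\oplus C_{mn}$.) *)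

(* Defs.v *)
From HB Require Import structures.
From mathcomp Require Import all_boot all_order all_fingroup all_algebra.

Set Implicit Arguments.
Unset Strict Implicit.
Unset Printing Implicit Defensive.

Import GRing.Theory.
Local Open Scope ring_scope.

(* The sum ranges over sets of positions of S, so repeated terms of S are
   summed with multiplicity. *)
Definition zero_sumfree (G : zmodType) (S : seq G) : Prop :=
  forall I : {set 'I_(size S)}, I != set0 -> \sum_(i in I) S`_i != 0.

(* k = 0 is allowed, so 1 counts as a prime power. *)
Definition prime_power (n : nat) : Prop :=
  exists p k : nat, prime p /\ n = (p ^ k)%N.

(* G is isomorphic to the direct sum of C_a and C_b, for a, b > 0.  The cyclic
   groups are the subgroups Zp a and Zp b rather than the full types 'Z_a and
   'Z_b, because 'Z_1 has two elements whereas Zp 1 is trivial. *)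
Definition isog_dsum_cyclic (G : finZmodType) (a b : nat) : bool :=
  ([set: G] \isog setX (Zp a) (Zp b))%g.

(* The number of terms of S, with multiplicity, whose additive order is d. *)
Definition count_order (G : finZmodType) (d : nat) (S : seq G) : nat :=
  count (fun g : G => #[g]%g == d) S.

(* Main.v *)
(* A term of order less than mn is killed by mn/p for some prime p.  Lift S to
   Z^2 and fix p.  If p divides n, the elements killed by mn/p form a subgroup
   H = C_m + C_(mn/p) with quotient C_p: were m terms of S in H, the remaining
   mn - 2 terms would contain mn/p - 1 disjoint blocks of length at most p with
   sums in H, giving a zero-sumfree sequence in H longer than the Davenport
   constant allows.  If p divides m but not n, then H = C_(m/p) + C_(mn/p) has
   quotient C_p + C_p, and the same argument excludes even one such term.  So at
   most m - 1 terms are lost for each prime divisor of n, and a number n that is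
   not a prime power has at most 1 + n/5 prime divisors. *)
Require Import Defs.
From mathcomp Require Import all_boot all_order all_fingroup all_algebra.
From mathcomp Require Import all_solvable all_field.
From mathcomp Require Import zify ring lra.

Set Implicit Arguments.
Unset Strict Implicit.
Unset Printing Implicit Defensive.

Import GRing.Theory Num.Theory.
Local Open Scope ring_scope.

(** * Polynomial degree through iterated differences, and zero sums modulo a prime *)

Section FiniteDifferences.
Variables (V : zmodType) (R : comNzRingType).
Implicit Types (f h : V -> R) (s : seq V) (v g : V).

Fixpoint iter_diff s f v : R :=
  if s is g :: s' then iter_diff s' f v - iter_diff s' f (v + g) else f v.

(** Fréchet's notion of a polynomial map of degree less than [d]. *)
Definition deg_lt (d : nat) f : Prop :=
  forall s, (d <= size s)%N -> iter_diff s f =1 fun=> 0.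

Lemma eq_iter_diff s f h : f =1 h -> iter_diff s f =1 iter_diff s h.
Proof. by move=> efh; elim: s => [|g s IHs] v //=; rewrite !IHs. Qed.

Lemma iter_diff_shift s f g v :
  iter_diff s (fun u => f (u + g)) v = iter_diff s f (v + g).
Proof.
by elim: s v => [|x s IHs] v //=; rewrite !IHs -!addrA [x + g]addrC.
Qed.

Lemma iter_diffB s f h v :
  iter_diff s (fun u => f u - h u) v = iter_diff s f v - iter_diff s h v.
Proof. by elim: s v => [|x s IHs] v //=; rewrite !IHs; ring. Qed.

Lemma iter_diffZ s f a v :
  iter_diff s (fun u => f u * a) v = iter_diff s f v * a.
Proof. by elim: s v => [|x s IHs] v //=; rewrite !IHs; ring. Qed.

Lemma iter_diff_cons s g f v :
  iter_diff (g :: s) f v = iter_diff s (fun u => f u - f (u + g)) v.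
Proof. by rewrite /= iter_diffB iter_diff_shift. Qed.

Lemma deg_lt_leq d e f : (d <= e)%N -> deg_lt d f -> deg_lt e f.
Proof. by move=> le_de df s /(leq_trans le_de); apply: df. Qed.

Lemma deg_ltB d f h : deg_lt d f -> deg_lt d h -> deg_lt d (fun v => f v - h v).
Proof. by move=> df dh s ds v; rewrite iter_diffB df // dh // subr0. Qed.

Lemma deg_lt_cst a : deg_lt 1 (fun=> a).
Proof.
case=> [|g s] // _ v; rewrite iter_diff_cons.
rewrite (@eq_iter_diff _ _ (fun=> a * 0)) => [|u]; last by rewrite subrr mulr0.
by rewrite iter_diffZ mulr0.
Qed.

(** Product rule: the difference of [f * l] in direction [g] is [k * l] minus [l g] times a shift of
    [f], where [k] is the difference of [f] and has smaller degree. *)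
Lemma deg_ltM_additive d f (l : {additive V -> R}) :
  deg_lt d f -> deg_lt d.+1 (fun v => f v * l v).
Proof.
elim: d f => [|d IHd] f df [|g s] // ds v.
  have f0 u : f u = 0 by apply: (df [::]).
  rewrite (@eq_iter_diff _ _ (fun u => f u * 0)) => [|u]; last first.
    by rewrite f0 !mul0r.
  by rewrite iter_diffZ mulr0.
rewrite iter_diff_cons; set k := fun u : V => f u - f (u + g).
have dk : deg_lt d k.
  move=> t dt u; rewrite -[LHS](iter_diff_cons t g f u).
  exact: df.
rewrite (@eq_iter_diff _ _ (fun u => k u * l u - f (u + g) * l g)); last first.
  by move=> u; rewrite raddfD /k; ring.
rewrite iter_diffB iter_diffZ (iter_diff_shift s f) IHd // df //.
by rewrite mul0r subr0.
Qed.

Lemma deg_ltM_additiveX d f (l : {additive V -> R}) k :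
  deg_lt d f -> deg_lt (d + k) (fun v => f v * l v ^+ k).
Proof.
move=> df; elim: k => [|k IHk].
  by rewrite addn0 => s ds v; rewrite iter_diffZ df // mul0r.
move=> s; rewrite addnS => ds v.
rewrite (@eq_iter_diff _ _ (fun v => f v * l v ^+ k * l v)) => [|u].
  exact: (deg_ltM_additive _ IHk).
by rewrite exprSr mulrA.
Qed.

(** [iter_diff s f v] is [f v] plus signed values of [f] at [v] shifted by non-empty subsums of [s],
    so one of these values is nonzero. *)
Lemma iter_diff_neq s f v : iter_diff s f v != f v ->
  exists T U, [/\ perm_eq s (T ++ U), T != [::]
                & f (v + \sum_(x <- T) x) != 0].
Proof.
elim: s v => [|g s IHs] v /=; first by rewrite eqxx.
have [-> | /IHs[T [U [pT T0 fT]]] _] := eqVneq (iter_diff s f v) (f v);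
  last first.
  exists T, (g :: U); split=> //.
  by rewrite perm_sym -[g :: U]cat1s perm_catCA /= perm_cons perm_sym.
rewrite -subr_eq0 addrAC subrr add0r oppr_eq0 => nz.
have [f0 | fn0] := eqVneq (f (v + g)) 0; last first.
  by exists [:: g], s; split=> //; rewrite big_seq1.
have /IHs[T [U [pT T0 fT]]] : iter_diff s f (v + g) != f (v + g) by rewrite f0.
by exists (g :: T), U; split; rewrite ?perm_cons // big_cons addrA.
Qed.

End FiniteDifferences.

(* The product over l of 1 - l^(p-1) is the indicator function of the common
   kernel of the l's, and it has degree at most r(p-1). *)
Lemma elementary_davenport (p : nat) (V : zmodType)
    (ls : seq {additive V -> 'F_p}) (S : seq V) :
  prime p -> (size ls * (p - 1) < size S)%N ->
  exists T U, [/\ perm_eq S (T ++ U), T != [::] &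
    all (fun l : {additive V -> 'F_p} => l (\sum_(x <- T) x) == 0) ls].
Proof.
move=> p_pr szS.
pose F v : 'F_p :=
  \prod_(l <- ls) (1 - (l : {additive V -> 'F_p}) v ^+ (p - 1)).
have p1_gt0 : (0 < p - 1)%N by have := prime_gt1 p_pr; lia.
have degF : deg_lt (size ls * (p - 1)).+1 F.
  rewrite /F; elim: ls {szS F} => [|l ls IHls] s ds v.
    rewrite (@eq_iter_diff _ _ _ _ (fun=> 1)) ?deg_lt_cst // => u.
    by rewrite big_nil.
  set f := fun v : V => _ in IHls.
  rewrite (@eq_iter_diff _ _ _ _ (fun u => f u - f u * l u ^+ (p - 1)));
    last first.
    by move=> u; rewrite big_cons -/(f u); ring.
  apply: deg_ltB (ds) v => /=.
    by apply: deg_lt_leq IHls; lia.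
  apply: deg_lt_leq (@deg_ltM_additiveX _ _ _ _ l (p - 1) IHls).
  by rewrite mulSn; lia.
have F0 : F 0 = 1.
  rewrite /F big1 // => l _; rewrite raddf0 expr0n.
  by case: (p - 1)%N p1_gt0 => // k _; rewrite subr0.
(* [S] is longer than the degree of [F], so the difference along [S] vanishes, while [F 0 = 1]. *)
have /iter_diff_neq[T [U [pT T0 FT]]] : iter_diff S F 0 != F 0.
  by rewrite F0 degF // eq_sym oner_neq0.
exists T, U; split=> //; move: FT; rewrite add0r /F.
elim: ls {szS F F0 degF} => //= l ls IHls.
rewrite big_cons mulf_eq0 negb_or => /andP[nz /IHls ->]; rewrite andbT.
apply: contraNT nz => nz.
(* Fermat: a nonzero value of [l] would make its factor of [F] vanish. *)
suff -> : l (\sum_(x <- T) x) ^+ (p - 1) = 1 by rewrite subrr.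
apply: (mulfI nz); rewrite -exprS mulr1 subn1 prednK ?prime_gt0 //.
by rewrite -[in X in _ ^+ X](card_Fp p_pr) expf_card.
Qed.

(** * Sequences without forbidden subsums, and greedy extraction of blocks *)

Section SumAvoiding.
Variable V : zmodType.
Implicit Types (Z Q : pred V) (S T U B : seq V).

(** For [Z] equal to [pred1 0] this is zero-sumfreeness. Splitting up to permutation, instead of by
    index sets, lets a block be replaced by its sum. *)
Definition sum_avoiding Z S : Prop :=
  forall T U, perm_eq S (T ++ U) -> T != [::] -> ~~ Z (\sum_(x <- T) x).

Lemma sum_avoiding_perm Z S T :
  perm_eq S T -> sum_avoiding Z S -> sum_avoiding Z T.
Proof. by move=> pST avS A B /(perm_trans pST); apply: avS. Qed.

Lemma sum_avoiding_catl Z S T : sum_avoiding Z (S ++ T) -> sum_avoiding Z S.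
Proof.
move=> avST A B pS; apply: (avST A (B ++ T)).
by rewrite catA perm_cat2r.
Qed.

(** A subsequence using the merged term expands, with the same sum, to one containing [T]; any other
    one is already a subsequence of [U]. *)
Lemma sum_avoiding_merge Z T U : T != [::] ->
  sum_avoiding Z (T ++ U) -> sum_avoiding Z (\sum_(x <- T) x :: U).
Proof.
move=> T0 avTU A B pTU A0; set t := \sum_(x <- T) x in pTU.
have : t \in A ++ B by rewrite -(perm_mem pTU) mem_head.
rewrite mem_cat; have [tA _ | _ /= tB] := boolP (t \in A).
  have pA := perm_to_rem tA.
  rewrite (perm_big _ pA) big_cons -big_cat /=.
  apply: (avTU _ B); last first.
    by rewrite -size_eq0 size_cat addn_eq0 size_eq0 (negPf T0).
  rewrite -catA perm_cat2l -(perm_cons t) (perm_trans pTU) // -cat_cons.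
  by rewrite perm_cat2r.
apply: (avTU _ (T ++ rem t B)) => //.
rewrite perm_sym perm_catCA perm_cat2l -(perm_cons t) perm_sym.
rewrite (perm_trans pTU) //.
rewrite perm_sym -[t :: _]cat1s perm_catCA perm_cat2l perm_sym.
exact: perm_to_rem.
Qed.

(** [D] bounds the Davenport constant of the quotient by [Q]. The length bound is asked only of
    longer [U], since the last block of an extraction may be long. *)
Definition block_bound Q (D p : nat) : Prop :=
  forall U, (D <= size U)%N -> exists T U',
    [/\ perm_eq U (T ++ U'), T != [::], Q (\sum_(x <- T) x)
      & (D + p - 1 <= size U -> size T <= p)%N].

(** The sums of the extracted blocks join [T]. Each block but the last is taken from at least
    [D + p] terms, hence uses at most [p] of them; the last one needs only [D] terms. *)
Lemma extract_blocks Z Q D p k T U : block_bound Q D p ->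
  sum_avoiding Z (T ++ U) -> all Q T -> (D + k * p <= size U + p)%N ->
  exists B, [/\ sum_avoiding Z B, all Q B & size B = (size T + k)%N].
Proof.
move=> bQ; elim: k T U => [|k IHk] T U avTU QT szU.
  by exists T; rewrite addn0; split=> //; apply: sum_avoiding_catl avTU.
have [|A [U' [pU A0 QA szA]]] := bQ U; first by move: szU; rewrite mulSn; lia.
have avA : sum_avoiding Z ((\sum_(x <- A) x :: T) ++ U').
  rewrite cat_cons; apply: sum_avoiding_merge => //.
  apply: sum_avoiding_perm avTU.
  by rewrite perm_sym perm_catCA perm_cat2l perm_sym.
have QAT : all Q (\sum_(x <- A) x :: T) by rewrite /= QA.
have szUA : size U = (size A + size U')%N by rewrite (perm_size pU) size_cat.
case: k IHk szU => [|k] IHk szU.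
  exists (\sum_(x <- A) x :: T); split=> //; last by rewrite addn1.
  exact: sum_avoiding_catl avA.
have [|B [avB QB szB]] := IHk _ _ avA QAT.
  have : (size A <= p)%N by apply: szA; move: szU; rewrite !mulSn; lia.
  by move: szU; rewrite !mulSn; lia.
by exists B; rewrite szB addSnnS.
Qed.

End SumAvoiding.

Lemma sum_avoiding_map (V W : zmodType) (f : V -> W) (Z : pred W) (S : seq V) :
  f 0 = 0 -> {morph f : u v / u + v} ->
  sum_avoiding Z (map f S) -> sum_avoiding (preim f Z) S.
Proof.
move=> f0 fD avS T U /(perm_map f); rewrite map_cat => pS T0.
rewrite /= (big_morph f fD f0) -(big_map f xpredT id) /=.
by apply: avS pS _; rewrite -size_eq0 size_map size_eq0.
Qed.

(** * Sublattices of Z^2 and short blocks modulo a prime *)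

(** Elements of C_a + C_b are represented in Z^2 modulo this lattice, so that subgroups become
    intermediate lattices and no quotient is constructed. *)
Definition lattice (a b : nat) (v : int * int) : bool :=
  (a %| v.1)%Z && (b %| v.2)%Z.

Lemma latticeB a b u v : lattice a b u -> lattice a b v -> lattice a b (u - v).
Proof.
by move=> /andP[u1 u2] /andP[v1 v2]; rewrite /lattice !rpredB.
Qed.

Section PrimeBlocks.
Variable p : nat.
Hypothesis p_pr : prime p.

Let dvdpE (z : int) : (p %| z)%Z = (z%:~R == 0 :> 'F_p).
Proof. exact: dvdz_pcharf (pchar_Fp p_pr) z. Qed.

(** Any [p] terms contain a block, and searching only the first [p] terms bounds its length. *)
Lemma block_bound_cyclic : block_bound (lattice 1 p) p p.
Proof.
move=> U szU.
have [|T [W [pU T0]]] := @elementary_davenport p _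
    [:: intr \o snd : {additive int * int -> 'F_p}] (take p U) p_pr.
  by rewrite size_takel //= mul1n subn1 prednK ?prime_gt0.
rewrite /= andbT -dvdpE => zT; exists T, (W ++ drop p U); split=> //.
- by rewrite catA -{1}[U](cat_take_drop p) perm_cat2r.
- by rewrite /lattice dvd1z.
by move=> _; rewrite -(size_takel szU) (perm_size pU) size_cat leq_addr.
Qed.

Lemma rank2_davenport (U : seq (int * int)) : (2 * p - 1 <= size U)%N ->
  exists T U' : seq (int * int),
    [/\ perm_eq U (T ++ U'), T != [::] & lattice p p (\sum_(x <- T) x)].
Proof.
move=> szU; have [|T [W [pU T0]]] := @elementary_davenport p _
    [:: intr \o fst : {additive int * int -> 'F_p};
        intr \o snd : {additive int * int -> 'F_p}] U p_pr.
  by move=> /=; have := prime_gt0 p_pr; lia.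
by rewrite /= andbT -!dvdpE => zT; exists T, W.
Qed.

(* Appending a coordinate 1 to all terms forces the length of a zero-sum
   subsequence to be p or 2p; in the latter case it splits in two. *)
Lemma rank2_short_zero_sum (U : seq (int * int)) : size U = (3 * p - 2)%N ->
  exists T U' : seq (int * int),
    [/\ perm_eq U (T ++ U'), T != [::], lattice p p (\sum_(x <- T) x)
       & (size T <= p)%N].
Proof.
move=> szU; have p_gt0 := prime_gt0 p_pr.
pose c (v : int * int) : int * int * int := (v, 1).
have [|T [W [pU T0]]] := @elementary_davenport p _
    [:: intr \o (fst \o fst) : {additive int * int * int -> 'F_p};
        intr \o (snd \o fst) : {additive int * int * int -> 'F_p};
        intr \o snd : {additive int * int * int -> 'F_p}] (map c U) p_pr.
  by rewrite size_map /=; lia.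
rewrite /= andbT -!dvdpE => /and3P[z1 z2 z3].
have szT : \sum_(x <- T) x.2 = (size T)%:Z.
  rewrite -sum1_size -natz natr_sum [LHS]big_seq [RHS]big_seq.
  apply: eq_bigr => x xT.
  have : x \in map c U by rewrite (perm_mem pU) mem_cat xT.
  by case/mapP=> v _ ->.
have {}z3 : (p %| size T)%N.
  by move: z3; rewrite (raddf_sum snd) /= szT.
have szTW : (size T <= size U)%N.
  by have /perm_size := pU; rewrite size_map size_cat => ->; apply: leq_addr.
have {}pU : perm_eq U (map fst T ++ map fst W).
  move/(perm_map fst): pU; rewrite map_cat -map_comp.
  by rewrite (eq_map (g := id)) ?map_id.
have zT : lattice p p (\sum_(x <- map fst T) x).
  by rewrite big_map -(raddf_sum fst) /lattice z1.
have T0' : (0 < size T)%N by rewrite lt0n size_eq0.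
have [szTp | ltpT] := leqP (size T) p.
  by exists (map fst T), (map fst W); rewrite -size_eq0 size_map size_eq0.
have {}szT : size (map fst T) = (2 * p)%N.
  rewrite size_map; case/dvdnP: z3 => k kE; move: szTW ltpT T0'.
  rewrite kE szU => le_k lt_k _.
  have : (k * p < 3 * p)%N by lia.
  have : (1 * p < k * p)%N by rewrite mul1n.
  by rewrite !ltn_pmul2r //; case: k {kE le_k lt_k} => [|[|[|k]]].
(* Setting [x] aside leaves 2p - 1 terms, enough for a zero sum [A], and keeps its complement
   [x :: B] non-empty. The complement is zero-sum too, and one of the two has length at most [p]. *)
case: (map fst T) szT pU zT => [|x T1] /= szT pU zT; first lia.
have [|A [B [pT A0 zA]]] := @rank2_davenport T1; first lia.
have szAB : (size A + size B = 2 * p - 1)%N.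
  by rewrite -size_cat -(perm_size pT) -szT subn1.
have [szA | ltA] := leqP (size A) p.
  exists A, (x :: B ++ map fst W); split=> //.
  rewrite (perm_trans pU) // -[x :: B ++ _]cat1s perm_sym perm_catCA /=.
  rewrite perm_cons.
  by rewrite catA perm_sym perm_cat2r.
exists (x :: B), (A ++ map fst W); split=> //=; last first.
- lia.
- rewrite big_cons; move: zT; rewrite big_cons (perm_big _ pT) big_cat /=.
  by move=> /latticeB /(_ zA); rewrite addrCA [X in lattice _ _ X]addrC addKr.
- rewrite (perm_trans pU) //= perm_cons catA perm_cat2r.
  by rewrite (perm_trans pT) // perm_catC.
Qed.

Lemma block_bound_rank2 : block_bound (lattice p p) (2 * p - 1) p.
Proof.
move=> U szU; have p_gt0 := prime_gt0 p_pr.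
have [szU3 | ltU] := leqP (3 * p - 2) (size U); last first.
  have [T [W [pU T0 zT]]] := rank2_davenport szU.
  by exists T, W; split=> //; lia.
have [|T [W [pU T0 zT szT]]] := @rank2_short_zero_sum (take (3 * p - 2) U).
  by rewrite size_takel.
exists T, (W ++ drop (3 * p - 2) U); split=> //.
by rewrite catA -{1}[U](cat_take_drop (3 * p - 2)) perm_cat2r.
Qed.

End PrimeBlocks.

(** * Davenport constants in rank at most two *)

(** Dividing the coordinates by [c] and [d] identifies cZ + dZ with Z^2 and caZ + dbZ with aZ +
    bZ. *)
Lemma lattice_rescale (a b c d : nat) (B : seq (int * int)) :
  (0 < c)%N -> (0 < d)%N -> all (lattice c d) B ->
  sum_avoiding (lattice (c * a) (d * b)) B ->
  exists2 B', size B' = size B & sum_avoiding (lattice a b) B'.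
Proof.
move=> c_gt0 d_gt0 /allP cdB avB.
pose f (v : int * int) : int * int := (c%:Z * v.1, d%:Z * v.2).
pose h (v : int * int) : int * int := ((v.1 %/ c)%Z, (v.2 %/ d)%Z).
exists (map h B); first by rewrite size_map.
have fhB : map f (map h B) = B.
  rewrite -map_comp -[RHS]map_id; apply/eq_in_map => v /cdB/andP[c1 d2].
  by rewrite /f /= ![_%:Z * _]mulrC !divzK //; case: (v).
rewrite -fhB in avB.
have fD : {morph f : u v / u + v}.
  by move=> u v; rewrite /f !mulrDr.
have f0 : f 0 = 0 by rewrite /f !mulr0.
move=> T U pT T0; have := sum_avoiding_map f0 fD avB pT T0.
by rewrite /= /lattice !PoszM !dvdz_mul2l ?eqz_nat -?lt0n.
Qed.

(** The Davenport constant of C_a + C_b is at most a + b - 1, written without truncated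
    subtraction. *)
Definition davenport_le (a b : nat) : Prop :=
  forall S, sum_avoiding (lattice a b) S -> (size S + 2 <= a + b)%N.

(** The inductive method: [T] and the [k] block sums cut from [U] form a sequence inside cZ + dZ,
    which rescales to one over C_a + C_b. *)
Lemma quotient_davenport (a b c d D p k : nat) (T U : seq (int * int)) :
  (0 < c)%N -> (0 < d)%N -> block_bound (lattice c d) D p ->
  davenport_le a b -> sum_avoiding (lattice (c * a) (d * b)) (T ++ U) ->
  all (lattice c d) T -> (D + k * p <= size U + p)%N ->
  (size T + k + 2 <= a + b)%N.
Proof.
move=> c_gt0 d_gt0 bD dav avTU cdT szU.
have [B [avB cdB <-]] := extract_blocks bD avTU cdT szU.
by have [B' <-] := lattice_rescale c_gt0 d_gt0 cdB avB; apply: dav.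
Qed.

(** Induction through a prime [p] with n = kp: a sequence of length [n] would yield [k] blocks of
    sum divisible by [p], too many for C_k. *)
Lemma davenport_cyclic (n : nat) : (0 < n)%N -> davenport_le 1 n.
Proof.
elim/ltn_ind: n => n IHn n_gt0 S avS.
have [n_le1 | n_gt1] := leqP n 1.
  have n1 : n = 1%N by lia.
  case: S avS => [|x S] avS; first by rewrite n1.
  by have := avS [:: x] S (perm_refl _) isT; rewrite n1 /lattice !dvd1z.
have p_pr := pdiv_prime n_gt1; have p_gt1 := prime_gt1 p_pr.
have /dvdnP[k nE] := pdiv_dvd n; set p := pdiv n in p_pr p_gt1 nE.
have k_gt0 : (0 < k)%N by lia.
rewrite leqNgt; apply/negP => szS.
have davk : davenport_le 1 k by apply: IHn => //; nia.
have := @quotient_davenport 1 k 1 p p p k [::] S isT (prime_gt0 p_pr)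
  (block_bound_cyclic p_pr) davk.
rewrite muln1 [(p * k)%N]mulnC -nE => /(_ avS isT) bnd.
have /bnd : (p + n <= size S + p)%N by lia.
lia.
Qed.

(** Induction on [m] through the quotient C_p + C_p, with m = kp: a counterexample would yield k +
    kn - 1 blocks, one more than C_k + C_kn allows. The case m = 1 is cyclic. *)
Lemma davenport_rank2 (m n : nat) :
  (0 < m)%N -> (0 < n)%N -> davenport_le m (m * n).
Proof.
elim/ltn_ind: m => m IHm m_gt0 n_gt0.
have [m_le1 | m_gt1] := leqP m 1.
  have -> : m = 1%N by lia.
  by rewrite mul1n; apply: davenport_cyclic.
move=> S avS; have p_pr := pdiv_prime m_gt1; have p_gt1 := prime_gt1 p_pr.
have /dvdnP[k mE] := pdiv_dvd m; set p := pdiv m in p_pr p_gt1 mE.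
have k_gt0 : (0 < k)%N by lia.
rewrite leqNgt; apply/negP => szS.
have davk : davenport_le k (k * n) by apply: IHm => //; nia.
have p_gt0 := prime_gt0 p_pr.
have := @quotient_davenport k (k * n) p p (2 * p - 1) p (k + k * n - 1) [::] S
  p_gt0 p_gt0 (block_bound_rank2 p_pr) davk.
rewrite mulnA [(p * k)%N]mulnC -mE => /(_ avS isT) bnd.
have /bnd : (2 * p - 1 + (k + k * n - 1) * p <= size S + p)%N.
  rewrite mulnBl mulnDl mul1n mulnAC -mE.
  have : (p <= m)%N by rewrite mE leq_pmull.
  lia.
lia.
Qed.

(** * Terms of a zero-sumfree sequence of maximal length lying in proper subgroups *)

Section LongSequences.
Variables (m n : nat) (S : seq (int * int)).
Hypotheses (m_gt0 : (0 < m)%N) (n_gt0 : (0 < n)%N).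
Hypothesis avS : sum_avoiding (lattice m (m * n)) S.
Hypothesis szS : size S = (m + m * n - 2)%N.

Lemma count_lattice_cyclic p : prime p -> (p %| n)%N ->
  (count (lattice 1 p) S <= m - 1)%N.
Proof.
move=> p_pr /dvdnP[k nE]; have p_gt1 := prime_gt1 p_pr.
have k_gt0 : (0 < k)%N by lia.
rewrite leqNgt; apply/negP => ltc.
pose F := filter (lattice 1 p) S; pose T := take m F.
pose U := drop m F ++ filter (predC (lattice 1 p)) S.
have pS : perm_eq S (T ++ U).
  by rewrite /T /U catA cat_take_drop perm_sym perm_filterC.
have szT : size T = m by rewrite size_takel // size_filter; lia.
have szU : size U = (m * n - 2)%N.
  by apply: (@addnI m); rewrite -{1}szT -size_cat -(perm_size pS) szS; nia.
have cT : all (lattice 1 p) T.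
  by apply/allP => x /mem_take; rewrite mem_filter => /andP[].
have := @quotient_davenport m (m * k) 1 p p p (m * k - 1) T U isT
  (prime_gt0 p_pr) (block_bound_cyclic p_pr) (davenport_rank2 m_gt0 k_gt0).
rewrite mul1n [(p * _)%N]mulnC -mulnA -nE szT szU.
have mk_gt0 : (0 < m * k)%N by rewrite muln_gt0 m_gt0.
move=> /(_ (sum_avoiding_perm pS avS) cT) bnd.
(* The left side equals mn, so this is where p >= 2 enters. The [m] terms of [T] and the mk - 1
   blocks exceed the bound m + mk - 2. *)
have /bnd : (p + (m * k - 1) * p <= m * n - 2 + p)%N.
  by rewrite mulnBl mul1n -mulnA -nE; nia.
lia.
Qed.

Lemma lattice_rank2_notin p x : prime p -> (p %| m)%N -> x \in S ->
  ~~ lattice p p x.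
Proof.
move=> p_pr /dvdnP[k mE] xS; have p_gt1 := prime_gt1 p_pr.
have p_gt0 := prime_gt0 p_pr.
have k_gt0 : (0 < k)%N by lia.
apply/negP => px; have pS := perm_to_rem xS.
have szU : size (rem x S) = (m + m * n - 3)%N by rewrite size_rem // szS; lia.
have := @quotient_davenport k (k * n) p p (2 * p - 1) p (k + k * n - 2)
  [:: x] (rem x S) p_gt0 p_gt0 (block_bound_rank2 p_pr)
  (davenport_rank2 k_gt0 n_gt0).
rewrite mulnA [(p * k)%N]mulnC -mE szU /= px.
have kn_gt0 : (0 < k * n)%N by rewrite muln_gt0 k_gt0.
move=> /(_ (sum_avoiding_perm pS avS) isT) bnd.
(* The left side equals m + mn - 1, again requiring p >= 2. With [x], the blocks number k + kn - 1,
   one too many. *)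
have /bnd : (2 * p - 1 + (k + k * n - 2) * p <= m + m * n - 3 + p)%N.
  have : (2 * p <= k * p + k * n * p)%N by nia.
  by rewrite mulnBl mulnDl mulnAC -mE; lia.
lia.
Qed.

End LongSequences.

(** * Counting the terms of lower order *)

Lemma count_has_leq (T I : Type) (P : I -> pred T) (c : nat)
    (r : seq I) (s : seq T) :
  all (fun i => (count (P i) s <= c)%N) r ->
  (count (fun x => has (fun i => P i x) r) s <= c * size r)%N.
Proof.
elim: r => [|i r IHr] /=; first by rewrite count_pred0.
case/andP=> ci /IHr cr; rewrite mulnS (leq_trans _ (leq_add ci cr)) //.
by rewrite -count_predUI leq_addr.
Qed.

Section LowerOrder.
Variables (m n : nat) (S : seq (int * int)).
Hypotheses (m_gt0 : (0 < m)%N) (n_gt0 : (0 < n)%N).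
Hypothesis avS : sum_avoiding (lattice m (m * n)) S.
Hypothesis szS : size S = (m + m * n - 2)%N.

(** Being killed by mn/p forces [p] to divide the second coordinate. If [p] did not divide [n], it
    would divide [m] and also the first coordinate, which [lattice_rank2_notin] excludes. *)
Lemma lower_order_lattice v p : v \in S -> prime p -> (p %| m * n)%N ->
  lattice m (m * n) (v *+ (m * n %/ p)) -> (p %| n)%N && lattice 1 p v.
Proof.
move=> vS p_pr p_mn; set q := (m * n %/ p)%N.
have qE : (m * n = p * q)%N by rewrite [(p * q)%N]mulnC divnK.
have q_gt0 : (0 < q)%N.
  by have := muln_gt0 m n; rewrite qE m_gt0 n_gt0 muln_gt0 => /andP[].
rewrite /lattice (raddfMn fst) (raddfMn snd) !pmulrn !mulrzz => /andP[v1 v2].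
have {}v2 : (p %| v.2)%Z.
  by move: v2; rewrite qE PoszM dvdz_mul2r // eqz_nat -lt0n.
rewrite v2 dvd1z !andbT; apply: contraT => p_n.
have p_m : (p %| m)%N by move: p_mn; rewrite Euclid_dvdM // (negPf p_n) orbF.
have := lattice_rank2_notin m_gt0 n_gt0 avS szS p_pr p_m vS.
rewrite /lattice v2 andbT => /negP[]; case/dvdnP: p_m => k mE.
have k_gt0 : (0 < k)%N by lia.
have qkn : q = (n * k)%N.
  by apply/eqP; rewrite -(eqn_pmul2l (prime_gt0 p_pr)) -qE mE; apply/eqP; lia.
(* With m = kp and q = nk, the first-coordinate condition says kp divides [v.1] nk; cancelling [k]
   and the coprime factor [n] gives p | [v.1]. *)
have : (k%:Z * p%:Z %| k%:Z * (v.1 * n%:Z))%Z.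
  have <- : v.1 * q%:Z = k%:Z * (v.1 * n%:Z) by rewrite qkn PoszM; ring.
  by rewrite -PoszM -mE.
rewrite dvdz_mul2l ?eqz_nat -?lt0n // Gauss_dvdzl //.
by rewrite coprimezE /= prime_coprime.
Qed.

Lemma count_lower_order :
  (count (fun v => has (fun p => lattice m (m * n) (v *+ (m * n %/ p)))
     (primes (m * n))) S <= (m - 1) * size (primes n))%N.
Proof.
pose bad v := has (fun p => lattice 1 p v) (primes n).
apply: (@leq_trans (count bad S)).
  set low := fun v => _; rewrite (@eq_in_count _ low (predI low bad)).
    by apply: sub_count => v /andP[].
  move=> v vS /=; apply/idP/idP => [lowv | /andP[] //]; rewrite lowv /=.
  have /hasP[p] := lowv; rewrite mem_primes => /and3P[p_pr _ p_mn] lat_v.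
  have /andP[p_n pv] := lower_order_lattice vS p_pr p_mn lat_v.
  by apply/hasP; exists p; rewrite // mem_primes p_pr n_gt0.
apply: count_has_leq; apply/allP => p; rewrite mem_primes => /and3P[p_pr _ p_n].
exact (count_lattice_cyclic m_gt0 n_gt0 avS szS p_pr p_n).
Qed.

End LowerOrder.

(** * Bounds on the number of prime divisors *)

(** The i-th smallest prime divisor is at least i + 1, and the product of the prime divisors is at
    most [n]. *)
Lemma leq_fact_primes n : (0 < n)%N -> ((size (primes n)).+1`! <= n)%N.
Proof.
move=> n_gt0.
have path_fact a s :
    path ltn a s -> ((a + size s)`! <= a`! * \prod_(x <- s) x)%N.
  elim: s a => [|x s IHs] a /=; first by rewrite addn0 big_nil muln1.
  case/andP=> lt_ax xs; rewrite -addSnnS big_cons.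
  have /IHs/leq_trans-> // : path ltn a.+1 s.
    case: s xs {IHs} => //= y s /andP[lt_xy ->]; rewrite andbT.
    exact: leq_trans lt_xy.
  by rewrite factS mulnA leq_mul2r [(a`! * x)%N]mulnC leq_mul2r lt_ax !orbT.
have : path ltn 1 (primes n).
  rewrite path_min_sorted ?sorted_primes //.
  by apply/allP => p; rewrite mem_primes => /andP[/prime_gt1].
move/path_fact; rewrite (_ : 1`! = 1)%N // mul1n add1n => /leq_trans; apply.
rewrite [leqRHS](prod_prime_decomp n_gt0) prime_decompE big_map /=.
rewrite big_seq [leqRHS]big_seq; apply: leq_prod => p.
rewrite mem_primes => /and3P[p_pr _ p_n].
by rewrite -{1}[p]expn1 leq_exp2l ?prime_gt1 // logn_gt0 mem_primes p_pr n_gt0.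
Qed.

Lemma size_primes_prime_power n : prime_power n -> (size (primes n) <= 1)%N.
Proof.
case=> p [[|k] [p_pr ->]] //; by rewrite primesX // primes_prime.
Qed.

Lemma size_primes_not_prime_power n : (0 < n)%N -> ~ prime_power n ->
  (5 * (size (primes n) - 1) <= n)%N.
Proof.
move=> n_gt0 npp; apply: leq_trans (leq_fact_primes n_gt0).
case: (size (primes n)) (erefl (size (primes n))) => [|[|w]] // _.
(* There are [w.+2] primes here: 5 is at most (w+3)(w+2), and w + 1 at most (w+1)!. *)
rewrite subn1 /= [_.+3`!]factS [w.+2`!]factS mulnA leq_mul ?fact_geq //.
nia.
Qed.

(** * Transfer between the group and Z^2, and the final count *)

Lemma zero_sumfree_avoiding (G : zmodType) (S : seq G) :
  zero_sumfree S -> sum_avoiding (pred1 0) S.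
Proof.
move=> zsfS T U pS T0.
(* A sub-multiset of [S] is, up to order, selected by a mask [b], whose true positions form the
   index set [I]. *)
have [|b szb pT] := proj1 (count_maskP T S).
  by move=> x; rewrite (seq.permP pS) count_cat leq_addr.
rewrite (perm_big _ pT) big_mask /=.
pose I := [set i : 'I_(size S) | nth false b i].
have I0 : I != set0.
  apply: contra T0 => /eqP I0; rewrite -size_eq0 (perm_size pT) size_mask //.
  rewrite -leqn0 leqNgt -has_count; apply/negP => /(has_nthP false)[i ltib bi].
  rewrite szb in ltib.
  have : Ordinal ltib \in I by rewrite inE.
  by rewrite I0 inE.
have := zsfS I I0; congr (_ != 0).
apply: eq_big => [i | i _]; first by rewrite inE andbT.
by rewrite (tnth_nth 0).
Qed.

(* f is (x, y) |-> x g1 + y g2, and identifies G with Z^2 / (aZ + bZ). *)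
Lemma isog_dsum_cyclic_coordinates (G : finZmodType) (a b : nat) :
  (0 < a)%N -> (0 < b)%N -> isog_dsum_cyclic G a b ->
  exists f : int * int -> G,
    [/\ f 0 = 0, {morph f : u v / u + v}, forall x, exists v, f v = x
      & forall v, (f v == 0) = lattice a b v].
Proof.
move=> a_gt0 b_gt0; rewrite /isog_dsum_cyclic isog_sym => /isogP[h inj_h imh].
have Zp_gen (c : nat) : (0 < c)%N ->
    exists2 x : 'Z_c, Zp c = <[x]>%g & #[x]%g = c.
  move=> c_gt0; have [x xE] : exists x : 'Z_c, Zp c = <[x]>%g.
    rewrite /Zp; case: ifP => _; last by exists 1%g; rewrite cycle1.
    by exists Zp1; rewrite -Zp_cycle.
  by exists x; rewrite // orderE -xE card_Zp.
have [x1 x1E o1] := Zp_gen a a_gt0; have [x2 x2E o2] := Zp_gen b b_gt0.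
have dom (i j : nat) : (x1 ^+ i, x2 ^+ j)%g \in setX (Zp a) (Zp b).
  by rewrite inE /= x1E x2E !mem_cycle.
pose g1 := h (x1, 1%g); pose g2 := h (1%g, x2).
have hE (i j : nat) : g1 *+ i + g2 *+ j = h (x1 ^+ i, x2 ^+ j)%g.
  have d1 : (x1, 1%g) \in setX (Zp a) (Zp b) by have := dom 1%N 0%N.
  have d2 : (1%g, x2) \in setX (Zp a) (Zp b) by have := dom 0%N 1%N.
  rewrite -!FinRing.zmodXgE -FinRing.zmodMgE -!morphX // -morphM ?groupX //.
  have pairX (x : 'Z_a) (y : 'Z_b) k : ((x, y) ^+ k = (x ^+ k, y ^+ k))%g.
    by elim: k => // k IHk; rewrite !expgS IHk.
  rewrite !pairX !expg1n; congr (h _).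
  by rewrite -[LHS]/(_ * 1, 1 * _)%g mulg1 mul1g.
have ker (i j : nat) : (g1 *+ i + g2 *+ j == 0) = (a %| i)%N && (b %| j)%N.
  rewrite hE -(FinRing.zmod1gE G) (morph_injm_eq1 inj_h) //.
  by rewrite -[1%g]/(1%g, 1%g) xpair_eqE -!order_dvdn o1 o2.
exists (fun v => g1 *~ v.1 + g2 *~ v.2); split.
- by rewrite !mulr0z addr0.
- by move=> u v; rewrite !mulrzDr addrACA.
- move=> x; have : x \in (h @* setX (Zp a) (Zp b))%g by rewrite imh inE.
  case/morphimP=> -[y1 y2] _ /setXP[y1Z y2Z] ->.
  have /cycleP[i y1E] : y1 \in <[x1]>%g by rewrite -x1E.
  have /cycleP[j y2E] : y2 \in <[x2]>%g by rewrite -x2E.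
  rewrite y1E y2E.
  by exists (i%:Z, j%:Z); rewrite /= -!pmulrn hE.
move=> [i j]; rewrite /lattice /=.
have g1a : g1 *+ a = 0.
  by have /eqP := ker a 0%N; rewrite mulr0n addr0 dvdnn dvdn0 => /eqP/eqP.
have g2b : g2 *+ b = 0.
  by have /eqP := ker 0%N b; rewrite mulr0n add0r dvdnn dvdn0 => /eqP/eqP.
(* Integer coefficients are reduced modulo [c] to naturals, so that [ker] applies. *)
have red (g : G) (c : nat) (z : int) : (0 < c)%N -> g *+ c = 0 ->
    exists2 k : nat, g *~ z = g *+ k & (c %| z)%Z = (c %| k)%N.
  move=> c_gt0 gc; have c0 : c%:Z != 0 by rewrite eqz_nat -lt0n.
  exists `|(z %% c)%Z|%N.
    rewrite {1}(divz_eq z c) mulrzDr mulrC mulrzA -pmulrn gc mul0rz add0r.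
    by rewrite pmulrn gez0_abs ?modz_ge0.
  rewrite -[RHS]/(c%:Z %| (z %% c)%Z)%Z {1}(divz_eq z c).
  by rewrite rpredDl // dvdz_mull.
have [k1 -> ->] := red g1 a i a_gt0 g1a.
have [k2 -> ->] := red g2 b j b_gt0 g2b.
exact: ker.
Qed.

(** The order properly divides [N]; any prime divisor of the cofactor [q] serves. *)
Lemma prime_div_order (gT : finGroupType) (x : gT) (N : nat) : (0 < N)%N ->
  (x ^+ N = 1)%g -> #[x]%g != N ->
  exists2 p, p \in primes N & (x ^+ (N %/ p) = 1)%g.
Proof.
move=> N_gt0 /eqP; rewrite -order_dvdn => /dvdnP[q NE] neqN.
have q_gt1 : (1 < q)%N.
  by case: q NE neqN => [|[|q]] // NE; rewrite NE ?mul1n ?eqxx // in N_gt0 *.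
exists (pdiv q).
  by rewrite mem_primes pdiv_prime // N_gt0 NE dvdn_mulr // pdiv_dvd.
apply/eqP; rewrite -order_dvdn NE -divn_mulAC ?pdiv_dvd //.
exact: dvdn_mull.
Qed.

Lemma count_order_lower_bound (m n : nat) (G : finZmodType) (S : seq G) :
  (0 < m)%N -> (0 < n)%N -> isog_dsum_cyclic G m (m * n) ->
  zero_sumfree S -> size S = (m + m * n - 2)%N ->
  (m + m * n - 2 <= count_order (m * n) S + (m - 1) * size (primes n))%N.
Proof.
move=> m_gt0 n_gt0 isoG zsfS szS.
have mn_gt0 : (0 < m * n)%N by rewrite muln_gt0 m_gt0.
have [f [f0 fD f_surj f_ker]] := isog_dsum_cyclic_coordinates m_gt0 mn_gt0 isoG.
have [S' S'E] : exists S', map f S' = S.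
  elim: (S) => [|x s [s' <-]]; first by exists [::].
  by have [v <-] := f_surj x; exists (v :: s').
have {}szS : size S' = (m + m * n - 2)%N by rewrite -szS -S'E size_map.
have avS' : sum_avoiding (lattice m (m * n)) S'.
  move=> T U pT T0; rewrite -f_ker.
  suff /(_ T U pT T0) : sum_avoiding (preim f (pred1 0)) S' by [].
  by apply: sum_avoiding_map => //; rewrite S'E; apply: zero_sumfree_avoiding.
have := count_lower_order m_gt0 n_gt0 avS' szS.
set low := fun v => _; rewrite -(leq_add2l (count_order (m * n) S)).
apply: leq_trans; rewrite -szS /count_order -S'E count_map.
rewrite -(count_predC (preim f (fun g : G => #[g]%g == (m * n)%N)) S') leq_add2l.
(* A term whose order is not mn is killed by mn/p for some prime p, hence is counted by [low]. *)
apply: sub_count => v /= neqmn; have fX k : (f v ^+ k)%g = f (v *+ k).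
  rewrite FinRing.zmodXgE; elim: k => [|k IHk]; first by rewrite f0.
  by rewrite !mulrS IHk fD.
have [|p p_mn] := prime_div_order mn_gt0 _ neqmn.
  rewrite fX; apply/eqP; rewrite -[1%g]/(0 : G) f_ker.
  rewrite /lattice (raddfMn fst) (raddfMn snd) !pmulrn !mulrzz.
  by rewrite !dvdz_mull // PoszM dvdz_mulr.
rewrite fX => /eqP fp; apply/hasP; exists p => //.
by rewrite -f_ker.
Qed.

Theorem theorem2p5 (m n : nat) (G : finZmodType) (S : seq G) :
  (0 < m)%N -> (0 < n)%N ->
  isog_dsum_cyclic G m (m * n) ->
  zero_sumfree S ->
  size S = (m + m * n - 2)%N ->
  (prime_power n -> (m * n - 1 <= count_order (m * n) S)%N) /\
  (~ prime_power n ->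
     (Num.ceil ((4 / 5 * (m * n)%:R + (n%:R - 5) / 5)%R : rat)
        <= (count_order (m * n) S)%:Z)%R).
Proof.
move=> m_gt0 n_gt0 isoG zsfS szS.
have := count_order_lower_bound m_gt0 n_gt0 isoG zsfS szS.
move: (count_order _ _) => c bnd; split=> [pp | npp].
  (* At most m - 1 terms are lost, leaving mn - 1. *)
  have := leq_mul (leqnn (m - 1)) (size_primes_prime_power pp); lia.
rewrite ceil_le_int.
have w5 := size_primes_not_prime_power n_gt0 npp.
(* Five times the number of prime divisors is at most n + 5; expanding the products then gives 5c >=
   4mn + n - 5. *)
have : (5 * (m + m * n - 2) <= 5 * c + (m - 1) * (n + 5))%N.
  apply: (@leq_trans (5 * (c + (m - 1) * size (primes n)))).
    by rewrite leq_mul2l.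
  by rewrite mulnDr leq_add2l mulnCA leq_mul2l; apply/orP; right; lia.
have mE : (m * n = (m - 1) * n + n)%N by rewrite -mulSnr subn1 prednK.
move=> le_c; have {le_c} : (4 * (m * n) + n <= 5 * c + 5)%N.
  by move: le_c; rewrite mE [((m - 1) * (n + 5))%N]mulnDr; lia.
rewrite -(ler_nat rat) !natrD !natrM -pmulrn => le_c.
lra.
Qed.
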